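(* In every chordal $(3,3)$-coloring of $K_n$ there is a strong cover of all vertices, and $\theta(K_n)\le 3$. Moreover, equality can occur for interval colorings: there is an interval $(3,3)$-coloring of $K_9$ with $\theta(K_9)=3$.
   Context: A $t$-coloring of $K_n$ is a representation of its edge set as a union $E(G_1)\cup\dots\cup E(G_t)$ of edge sets of $t$ graphs $G_1,\dots,G_t$ on $V(K_n)$; an edge may receive several colors. A clique of color $i$ is a vertex set spanning a complete subgraph of $G_i$. A $(t,k)$-coloring is a $t$-coloring in which every set of $k$ vertices (the whole vertex set if $n<k$) spans a clique of some color. It is chordal (resp. interval) if every $G_i$ is a chordal graph, i.e. has no induced cycle of length at least $4$ (resp. an interval graph). A strong cover is a covering of all vertices by monochromatic cliques of pairwise different colors; $\theta(K_n)$ is the minimum number of cliques in a strong cover. *)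

(* Defs.v *)
From HB Require Import structures.
From mathcomp Require Import all_boot all_order all_algebra.
From mathcomp Require Import reals.

Set Implicit Arguments.
Unset Strict Implicit.
Unset Printing Implicit Defensive.

Record sgraph (V : finType) := SGraph {
  adj :> rel V;
  adj_sym : symmetric adj;
  adj_irrefl : irreflexive adj }.

Definition clique (V : finType) (e : rel V) (S : {set V}) : bool :=
  [forall x in S, forall y in S, (x != y) ==> e x y].

(* [c] lists the vertices of the cycle in cyclic order. *)
Definition induced_cycle (V : finType) (e : rel V) (c : seq V) : Prop :=
  ucycle e c /\
  {in c &, forall x y, e x y -> y = next c x \/ x = next c y}.

Definition chordal (V : finType) (e : rel V) : Prop :=
  forall c : seq V, 4 <= size c -> ~ induced_cycle e c.

Definition interval_graph (R : realType) (V : finType) (e : rel V) : Prop :=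
  exists a b : V -> R,
    (forall v, (a v <= b v)%R) /\
    (forall u v, u != v ->
       e u v <-> exists x : R, (x \in `[a u, b u] /\ x \in `[a v, b v])%R).

(* The vertex set of K_n is ['I_n]; the [G i] need not be edge-disjoint. *)
Definition t_coloring (n t : nat) (G : 'I_t -> sgraph 'I_n) : Prop :=
  forall x y : 'I_n, x != y -> exists i, G i x y.

Definition monochromatic (n t : nat) (G : 'I_t -> sgraph 'I_n)
    (S : {set 'I_n}) : Prop :=
  exists i, clique (G i) S.

Definition tk_coloring (n t : nat) (k : nat) (G : 'I_t -> sgraph 'I_n) : Prop :=
  [/\ t_coloring G,
      forall S : {set 'I_n}, #|S| = k -> monochromatic G S
    & n < k -> monochromatic G [set: 'I_n]].

(* A pair [(i, S)] in [C] stands for the clique [S] taken in color [i]. *)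
Definition strong_cover (n t : nat) (G : 'I_t -> sgraph 'I_n)
    (C : {set 'I_t * {set 'I_n}}) : bool :=
  [&& [forall p in C, clique (G p.1) p.2],
      [forall p in C, forall q in C, (p != q) ==> (p.1 != q.1)]
    & \bigcup_(p in C) p.2 == [set: 'I_n]].

(* Without any strong cover the value is the junk [t * 2 ^ n], which exceeds
   [t] as soon as [0 < t] and [0 < n]; for [n = 0] the empty family is a
   strong cover. *)
Definition theta (n t : nat) (G : 'I_t -> sgraph 'I_n) : nat :=
  #|[arg min_(C < [set: 'I_t * {set 'I_n}] | strong_cover G C) #|C| ]|.

(* Main.v *)
Require Import Defs.
From mathcomp Require Import all_boot all_order all_algebra.
From mathcomp Require Import reals.

(* If [v w] has color 0 only, then the triples [v, w, u] force [v] to be joined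
   in color 0 to every [u].  So the ends of such edges form a clique [P] of
   color 0, and all pairs outside [P] have color 1 or 2; the vertices outside
   [P] split into a clique of color 1 and one of color 2 because the two graphs
   have no induced C4 or C5 (Gyarfas and Lehel). *)

Set Implicit Arguments.
Unset Strict Implicit.
Unset Printing Implicit Defensive.

(** * Cliques and induced cycles of length 4 and 5 *)

Lemma clique_edge (V : finType) (e : rel V) (S : {set V}) (x y : V) :
  clique e S -> x \in S -> y \in S -> x != y -> e x y.
Proof.
move=> /forall_inP/(_ x) h xS yS.
by move/(_ xS)/forall_inP/(_ y yS)/implyP: h; apply.
Qed.

Lemma cliqueP (V : finType) (e : rel V) (S : {set V}) :
  {in S &, forall x y, x != y -> e x y} -> clique e S.
Proof.
by move=> h; apply/forall_inP=> x xS; apply/forall_inP=> y yS; apply/implyP/h.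
Qed.

Section ShortCycles.

Variables (V : finType) (g : sgraph V).
Hypothesis chg : chordal g.

Lemma sgraph_neq (x y : V) : g x y -> x != y.
Proof. by apply: contraTneq => ->; rewrite adj_irrefl. Qed.

Lemma chordal_C4 (x y z w : V) :
  g x y -> g y z -> g z w -> g w x -> x != z -> y != w ->
  ~~ g x z -> ~~ g y w -> False.
Proof.
move=> xy yz zw wx nxz nyw xz yw; apply: (@chg [:: x; y; z; w]) => //.
have [nxy nyz nzw nwx] : [/\ x != y, y != z, z != w & w != x].
  by split; apply: sgraph_neq.
have ne := (negPf nxy, negPf nyz, negPf nzw, negPf nwx, negPf nxz, negPf nyw).
have ne' := (eq_sym y x, eq_sym z y, eq_sym w z, eq_sym x w, eq_sym z x,
  eq_sym w y).
split; first by rewrite /ucycle /= xy yz zw wx !inE !(ne, ne').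
move=> u v; rewrite !inE.
by do 2![case/or4P=> /eqP->]; rewrite ?adj_irrefl //= ?eqxx ?(ne, ne') ?eqxx;
  auto; rewrite ?(negPf xz) ?(negPf yw) // adj_sym ?(negPf xz) ?(negPf yw).
Qed.

Lemma chordal_C5 (x y z w v : V) :
  g x y -> g y z -> g z w -> g w v -> g v x ->
  x != z -> x != w -> y != w -> y != v -> z != v ->
  ~~ g x z -> ~~ g x w -> ~~ g y w -> ~~ g y v -> ~~ g z v -> False.
Proof.
move=> xy yz zw wv vx nxz nxw nyw nyv nzv xz xw yw yv zv.
apply: (@chg [:: x; y; z; w; v]) => //.
have [nxy nyz nzw nwv nvx] :
    [/\ x != y, y != z, z != w, w != v & v != x].
  by split; apply: sgraph_neq.
have ne := (negPf nxy, negPf nyz, negPf nzw, negPf nwv, negPf nvx,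
  negPf nxz, negPf nxw, negPf nyw, negPf nyv, negPf nzv).
have ne' := (eq_sym y x, eq_sym z y, eq_sym w z, eq_sym v w, eq_sym x v,
  eq_sym z x, eq_sym w x, eq_sym w y, eq_sym v y, eq_sym v z).
have no := (negPf xz, negPf xw, negPf yw, negPf yv, negPf zv).
split; first by rewrite /ucycle /= xy yz zw wv vx !inE !(ne, ne').
move=> s t; rewrite !inE.
by do 2![case/or4P=> [/eqP->|/eqP->|/eqP->|/orP[]/eqP->]];
  rewrite ?adj_irrefl //= ?eqxx ?(ne, ne') ?eqxx;
  auto; rewrite ?no // adj_sym ?no.
Qed.

End ShortCycles.

(** * Partition of a two-colored set into a red and a blue clique *)

Section TwoColors.

Variables (V : finType) (r b : sgraph V) (D : {set V}).
Hypotheses (chr : chordal r) (chb : chordal b).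
Hypothesis rbD : {in D &, forall x y, x != y -> r x y || b x y}.

Let nonblue (x y : V) := (x != y) && ~~ b x y.

(** These pairs measure how far [D :\: A] is from being a blue clique. *)
Let bad (A : {set V}) :=
  [set p : V * V | [&& p.1 \in D :\: A, p.2 \in D :\: A & nonblue p.1 p.2]].

Let nonblueC x y : nonblue x y = nonblue y x.
Proof. by rewrite /nonblue eq_sym adj_sym. Qed.

(* [N v] is the set of vertices of [A] that are not red-adjacent to [v].  A
   nonblue pair [x, y] outside [A] with [N x] of least size makes the exchange
   of [N x] for [x] an improvement. *)
Let improve (A : {set V}) :
  A \subset D -> clique r A -> bad A != set0 ->
  exists A' : {set V}, [/\ A' \subset D, clique r A' & bad A' \proper bad A].
Proof.
move=> sAD cA /set0Pn[p0 p0bad].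
pose N v := [set a in A | ~~ r a v].
case: (@arg_minnP _ p0 (fun p => p \in bad A) (fun p => #|N p.1|) p0bad).
move=> -[x y] {p0 p0bad}.
rewrite {1}/bad !inE /= => /and3P[/andP[xA xD] /andP[yA yD] xy] min.
have {}min z w : z \notin A -> z \in D -> w \notin A -> w \in D ->
    nonblue z w -> #|N x| <= #|N z|.
  move=> zA zD wA wD zw; apply: (min (z, w)).
  by rewrite /bad !inE /= zA zD wA wD.
have red z w : z \in D -> w \in D -> nonblue z w -> r z w.
  move=> zD wD /andP[nzw nb]; move: (rbD zD wD nzw).
  by rewrite (negPf nb) orbF.
have AB a v : a \in A -> v \notin A -> a != v.
  by move=> aA; apply: contraNneq => <-.
have blue a v : v \notin A -> v \in D -> a \in N v -> b a v.
  move=> vA vD; rewrite inE => /andP[aA nr].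
  by move: (rbD (subsetP sAD a aA) vD (AB a v aA vA)); rewrite (negPf nr).
(* Were [a] in [N z] but not in [N w], comparing sizes would give some [c] in [N w] but not in
   [N z], and [z, w, a, c] would be an induced red C4. *)
have nest z w : z \notin A -> w \notin A -> r z w -> #|N z| <= #|N w| ->
    N z \subset N w.
  move=> zA wA zw le; apply/subsetP=> a az; apply: contraT => aw.
  case: (boolP (N w \subset N z)) => [sub|/subsetPn[c cw cz]].
    by move: aw; rewrite (eqP (_ : N w == N z)) ?az // eqEcard sub.
  move: az aw cw cz; rewrite !inE => /andP[aA az]; rewrite aA negbK /= => aw.
  move=> /andP[cinA cw]; rewrite cinA negbK /= => cz.
  have nac : a != c by apply: contraNneq az => ->.
  exfalso; apply: (@chordal_C4 _ _ chr z w a c) => //.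
  - by rewrite adj_sym.
  - exact: clique_edge cA _ _ _.
  - by rewrite eq_sym AB.
  - by rewrite eq_sym AB.
  - by rewrite adj_sym.
  - by rewrite adj_sym.
have rxy := red _ _ xD yD xy.
have Nxy : N x \subset N y.
  by apply: nest => //; apply: min yA yD xA xD _; rewrite nonblueC.
(* Vertices leaving [A] must not create new bad pairs. If [a z] were one, it would be red, and [x z]
   would be blue, since otherwise [nest] puts [a] in [N z]. *)
have claim a z : a \in N x -> z \notin A -> z \in D -> ~~ nonblue a z.
  move=> ax zA zD; apply/negP => az.
  have [aA arx] : a \in A /\ ~~ r a x by move: ax; rewrite inE => /andP.
  have aD := subsetP sAD _ aA.
  have ay := subsetP Nxy _ ax.
  have raz := red _ _ aD zD az.
  have aNz : a \notin N z by rewrite inE raz andbF.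
  have nzy : z != y.
    by apply: contraTneq az => ->; rewrite /nonblue (blue _ _ yA yD ay) andbF.
  have nzx : z != x by apply: contraTneq raz => ->.
  case: (boolP (nonblue x z)) => [xz|].
    have /subsetP/(_ a ax) : N x \subset N z.
      apply: nest => //; first exact: red xz.
      by apply: min zA zD xA xD _; rewrite nonblueC.
    by rewrite (negPf aNz).
  rewrite /nonblue eq_sym nzx /= negbK => bxz.
  (* Otherwise [a, x, z, y] is an induced blue C4. *)
  have zy : nonblue z y.
    rewrite /nonblue nzy /=; apply/negP=> bzy.
    apply: (@chordal_C4 _ _ chb a x z y) => //.
    - exact: blue ax.
    - by rewrite adj_sym; apply: blue ay.
    - exact: AB.
    - by case/andP: xy.
    - by case/andP: az.
    - by case/andP: xy.
  (* The pair [z, y] competes in the minimum, so [N x] is no larger than [N z]; an inclusion of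
     [N z] in [N x] would be an equality and put [a] in [N z]. *)
  have /subsetPn[c cz cx] : ~~ (N z \subset N x).
    apply/negP => sub; suff /subsetP/(_ a ax) : N x \subset N z.
      by rewrite (negPf aNz).
    suff /eqP<- : N z == N x by [].
    by rewrite eqEcard sub (min z y).
  have rzy := red _ _ zD yD zy.
  (* As [z y] is red, [N z] and [N y] are nested; [a] lies in [N y] only, so [N z] is the smaller
     one. *)
  have cy : c \in N y.
    case/orP: (leq_total #|N z| #|N y|) => le.
      exact: subsetP (nest _ _ zA yA rzy le) c cz.
    have := subsetP (nest y z yA zA _ le) a ay.
    by rewrite adj_sym (negPf aNz) => /(_ rzy).
  move: cz cy cx ay; rewrite !inE => /andP[cinA cz] /andP[_ cy].
  rewrite cinA negbK aA /= => cx nay.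
  have nac : a != c by apply: contraNneq arx => ->.
  have rca : r c a by apply: clique_edge cA _ _ _; rewrite // eq_sym.
  have nax := AB _ _ aA xA; have nyc := AB _ _ cinA yA.
  have nzc := AB _ _ cinA zA; have nya := AB _ _ aA yA.
  (* A red [x z] closes the induced C4 [x, z, a, c]; otherwise [a, z, y, x, c] is an induced red
     C5. *)
  case: (boolP (r x z)) => [xz|nxz].
    apply: (@chordal_C4 _ _ chr x z a c) => //.
    - by rewrite adj_sym.
    - by rewrite adj_sym.
    - by rewrite eq_sym.
    - by rewrite eq_sym.
    - by rewrite adj_sym.
    - by rewrite adj_sym.
  apply: (@chordal_C5 _ _ chr a z y x c) => //.
  - by rewrite adj_sym.
  - by rewrite adj_sym.
  - by rewrite eq_sym.
  - by rewrite eq_sym.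
  - by rewrite adj_sym.
  - by rewrite adj_sym.
  - by rewrite adj_sym.
(* Two vertices of [N x] not joined in blue would give the induced blue C4 [a, x, c, y]. *)
have NxN : {in N x &, forall a c, ~~ nonblue a c}.
  move=> a c ax cx; apply/negP => /andP[nac bac].
  apply: (@chordal_C4 _ _ chb a x c y) => //.
  - exact: blue ax.
  - by rewrite adj_sym; apply: blue cx.
  - by apply: blue => //; apply: (subsetP Nxy).
  - by rewrite adj_sym; apply: blue => //; apply: (subsetP Nxy).
  - by case/andP: xy.
  - by case/andP: xy.
(* The exchange removes the bad pair [(x, y)]; by [claim] and [NxN] the vertices of [N x] add
   none. *)
exists (x |: (A :\: N x)); split.
- by rewrite subUset sub1set xD subDset subsetU // sAD orbT.
- apply: cliqueP => u v /setU1P[->|/setDP[uA uN]] /setU1P[->|/setDP[vA vN]] nuv.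
  + by rewrite eqxx in nuv.
  + by move: vN; rewrite inE vA negbK adj_sym.
  + by move: uN; rewrite inE uA negbK.
  + exact: clique_edge cA _ _ _.
- apply/properP; split; last first.
    by exists (x, y); rewrite /bad !inE /= ?xA ?yA ?xD ?yD ?eqxx.
  have out u : u \in D :\: (x |: (A :\: N x)) ->
      u \in N x \/ u \notin A /\ u \in D.
    rewrite in_setD in_setU1 in_setD negb_or negb_and negbK.
    by case/andP=> /andP[_ /orP[]]; auto.
  apply/subsetP=> -[u v]; rewrite /bad inE /=.
  move=> /and3P[/out[uN|[uA uD]] /out[vN|[vA vD]] uv].
  + by move: (NxN u v uN vN); rewrite uv.
  + by move: (claim u v uN vA vD); rewrite uv.
  + by move: (claim v u vN uA uD); rewrite nonblueC uv.
  + by rewrite /bad !inE /= uA uD vA vD.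
Qed.

(** A red clique in [D] with the fewest bad pairs has none, because [improve] would lower their
    number. *)
Lemma red_blue_clique_partition :
  exists A : {set V}, [/\ A \subset D, clique r A & clique b (D :\: A)].
Proof.
pose P (A : {set V}) := (A \subset D) && clique r A.
have P0 : P set0.
  by rewrite /P sub0set; apply: cliqueP => x y; rewrite inE.
case: (arg_minnP (fun A => #|bad A|) P0) => A /andP[sAD cA] min.
exists A; split=> //; apply: cliqueP => x y xB yB nxy; apply: contraT => nb.
have [|A' [sA' cA' /proper_card]] := improve sAD cA.
  by apply/set0Pn; exists (x, y); rewrite /bad inE /= xB yB /nonblue nxy.
by rewrite ltnNge min // /P sA'.
Qed.

End TwoColors.

(** * Strong covers as families of cliques indexed by colors *)

Lemma ord3P (i : 'I_3) : [\/ i = ord0, i = inord 1 | i = inord 2].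
Proof.
by case: i => [[|[|[|//]]]] h; [apply: Or31|apply: Or32|apply: Or33];
  apply: val_inj; rewrite /= ?inordK.
Qed.

Lemma strong_cover_card (n t : nat) (G : 'I_t -> sgraph 'I_n)
    (C : {set 'I_t * {set 'I_n}}) :
  strong_cover G C -> #|C| <= t.
Proof.
case/and3P=> _ /forall_inP diff _; rewrite -[leqRHS]card_ord.
rewrite -(card_in_imset (f := fst) (D := C)) ?max_card // => p q pC qC pq.
apply: contra_eq (pq) => npq.
by move/forall_inP/(_ q qC)/implyP: (diff p pC); apply.
Qed.

(** Indexing by colors makes the colors pairwise different; a color without a clique is given the
    empty set. *)
Lemma strong_cover_of_cliques (n t : nat) (G : 'I_t -> sgraph 'I_n)
    (S : 'I_t -> {set 'I_n}) :
  (forall i, clique (G i) (S i)) -> (forall v, exists i, v \in S i) ->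
  exists C, strong_cover G C.
Proof.
move=> cS cov; exists [set (i, S i) | i : 'I_t]; apply/and3P; split.
- by apply/forall_inP=> p /imsetP[i _ ->].
- apply/forall_inP=> p /imsetP[i _ ->]; apply/forall_inP=> q /imsetP[j _ ->].
  by apply/implyP; apply: contraNneq => /= ->.
- rewrite eqEsubset subsetT; apply/subsetP=> v _; have [i vi] := cov v.
  by apply/bigcupP; exists (i, S i); rewrite ?imset_f.
Qed.

(** A strong cover has at most one clique of each color, so the union over color [i] is that clique
    or empty. The last clause serves the lower bound on [theta]. *)
Lemma cliques_of_strong_cover (n t : nat) (G : 'I_t -> sgraph 'I_n)
    (C : {set 'I_t * {set 'I_n}}) :
  strong_cover G C -> exists S : 'I_t -> {set 'I_n},
    [/\ forall i, clique (G i) (S i), forall v, exists i, v \in S i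
      & forall i, i \notin fst @: C -> S i = set0].
Proof.
case/and3P=> /forall_inP cl /forall_inP diff /eqP cov.
exists (fun i => \bigcup_(p in C | p.1 == i) p.2); split.
- move=> i; apply: cliqueP => x y /bigcupP[p /andP[pC /eqP pi] xp].
  move=> /bigcupP[q /andP[qC /eqP qi] yq].
  have pq : p = q.
    apply: contraTeq isT => npq; move/forall_inP/(_ q qC): (diff p pC).
    by rewrite npq pi qi eqxx.
  by rewrite -pi; apply: clique_edge (cl p pC) xp _; rewrite pq.
- move=> v; have: v \in [set: 'I_n] by [].
  rewrite -cov => /bigcupP[p pC vp]; exists p.1.
  by apply/bigcupP; exists p; rewrite ?pC ?eqxx.
- move=> i iC; apply: big1 => p /andP[pC /eqP pi].
  by case/imsetP: iC; exists p.
Qed.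

Lemma theta_strong_cover (n t : nat) (G : 'I_t -> sgraph 'I_n) :
  (exists C, strong_cover G C) ->
  exists2 C, strong_cover G C & theta G = #|C|.
Proof.
move=> [C sC]; eexists; last by [].
(* The default set in [theta] need not be a strong cover, so [arg_minnP] does not apply to it. A
   failing search would contradict the minimum that is found with [C] as the default. *)
rewrite /arg_min /extremum; case: pickP => [D /andP[] //|none].
case: (@arg_minnP _ C (strong_cover G) (fun C => #|C|) sC) => D sD min.
have /negP[] := none D; apply/andP; split=> //.
by apply/forallP=> j; apply/implyP; apply: min.
Qed.

(** * Strong covers of chordal (3,3)-colorings *)

Lemma chordal_33_strong_cover (n : nat) (G : 'I_3 -> sgraph 'I_n) :
  tk_coloring 3 G -> (forall i, chordal (G i)) -> exists C, strong_cover G C.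
Proof.
move=> [col tri small] chG; case: (ltnP n 3) => [/small[i ci]|n3].
  (* With at most two vertices, the whole vertex set is a clique of one color [i]. *)
  apply: (@strong_cover_of_cliques _ _ _
    (fun j => if j == i then setT else set0)).
    move=> j; case: eqP => [-> //|_].
    by apply: cliqueP => x y; rewrite inE.
  by move=> v; exists i; rewrite eqxx inE.
pose G0 := G ord0; pose G1 := G (inord 1); pose G2 := G (inord 2).
pose P := [set v | [exists w, [&& w != v, ~~ G1 v w & ~~ G2 v w]]].
have univ v u : v \in P -> u != v -> G0 v u.
  rewrite inE => /existsP[w /and3P[wv v1 v2]] uv.
  have only0 i : G i v w -> i = ord0.
    by case: (ord3P i) => -> //; rewrite ?(negPf v1) ?(negPf v2).
  case: (eqVneq u w) => [->|uw].
    have [|i vw] := col v w; first by rewrite eq_sym.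
    by rewrite /G0 -(only0 i vw).
  have [|i ci] := tri [set v; w; u].
    rewrite -setUA !cardsU1 cards1 !inE !negb_or.
    by rewrite (eq_sym v) wv (eq_sym v) uv (eq_sym w) uw.
  have vw : G i v w.
    by apply: (clique_edge ci); rewrite ?inE ?eqxx ?orbT // eq_sym.
  rewrite /G0 -(only0 i vw).
  by apply: (clique_edge ci); rewrite ?inE ?eqxx ?orbT // eq_sym.
have [|A [sA cA cB]] :=
    @red_blue_clique_partition _ G1 G2 (~: P) (chG _) (chG _).
  move=> x y; rewrite inE => xP _ nxy; apply: contraR xP => /norP[n1 n2].
  by rewrite inE; apply/existsP; exists y; rewrite eq_sym nxy n1.
pose S (i : 'I_3) :=
  if i == ord0 then P else if i == inord 1 then A else ~: P :\: A.
have ne10 : (inord 1 == ord0 :> 'I_3) = false by rewrite -val_eqE /= inordK.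
have ne20 : (inord 2 == ord0 :> 'I_3) = false by rewrite -val_eqE /= inordK.
have ne21 : (inord 2 == inord 1 :> 'I_3) = false by rewrite -val_eqE /= !inordK.
apply: (@strong_cover_of_cliques _ _ _ S).
  move=> i; rewrite /S.
  case: (ord3P i) => ->; rewrite ?eqxx ?ne10 ?ne20 ?ne21 //.
  by apply: cliqueP => x y xP _ nxy; apply: univ; rewrite // eq_sym.
move=> v; case: (boolP (v \in P)) => vP; first by exists ord0; rewrite /S eqxx.
case: (boolP (v \in A)) => vA; first by exists (inord 1); rewrite /S ne10 eqxx.
by exists (inord 2); rewrite /S ne20 ne21 in_setD in_setC vA.
Qed.

(** * An interval (3,3)-coloring of [K_9] *)

(** Vertices 0, 4, 8 get the interval [0, 4], which meets all others; the translates of {0, 4, 8} by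
    multiples of 3 partition Z/9, so each vertex is universal in exactly one color. The other six
    intervals form the path 5-2-6-7-1 with the pendant edge 6-3. *)
Definition left_end (x : nat) := nth 0 [:: 0; 4; 0; 2; 0; 0; 1; 3; 0] x.
Definition right_end (x : nat) := nth 0 [:: 4; 4; 1; 2; 4; 0; 3; 4; 4] x.

(* The three interval graphs are the translates of one graph on Z/9 by
   multiples of 3: in color [i] vertex [x] gets the interval of [x - 3 i]. *)
Definition shift (i x : nat) := (x + 6 * i) %% 9.

Lemma left_le_right (i x : nat) :
  left_end (shift i x) <= right_end (shift i x).
Proof.
have /allP h : all (fun x => left_end x <= right_end x) (iota 0 9) by [].
by rewrite h // mem_iota ltn_pmod.
Qed.

(** Stated on numbers and reflexive, so that the finite checks run over all tuples by computation,
    repetitions included. *)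
Definition overlap (i x y : nat) :=
  (left_end (shift i x) <= right_end (shift i y)) &&
  (left_end (shift i y) <= right_end (shift i x)).

Definition interval_adj (i : 'I_3) (x y : 'I_9) := (x != y) && overlap i x y.

Lemma interval_adj_sym i : symmetric (interval_adj i).
Proof.
by move=> x y; rewrite /interval_adj eq_sym; congr (_ && _); apply: andbC.
Qed.

Lemma interval_adj_irrefl i : irreflexive (interval_adj i).
Proof. by move=> x; rewrite /interval_adj eqxx. Qed.

Definition interval_coloring (i : 'I_3) : sgraph 'I_9 :=
  SGraph (interval_adj_sym i) (interval_adj_irrefl i).

Lemma interval_coloring_triple (x y z : 'I_9) :
  exists i : 'I_3, [&& overlap i x y, overlap i x z & overlap i y z].
Proof.
have /allP/(_ x) h : all (fun x => all (fun y => all (fun z =>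
    has (fun i => [&& overlap i x y, overlap i x z & overlap i y z]) (iota 0 3))
  (iota 0 9)) (iota 0 9)) (iota 0 9) by vm_compute.
rewrite mem_iota in h; have {h} /allP/(_ y) h := h (ltn_ord x).
rewrite mem_iota in h; have {h} /allP/(_ z) h := h (ltn_ord y).
rewrite mem_iota in h; have {h} /hasP[i] := h (ltn_ord z).
by rewrite mem_iota => /andP[_ i3] h; exists (Ordinal i3).
Qed.

Lemma interval_coloring_33 : tk_coloring 3 interval_coloring.
Proof.
have cl (x y z : 'I_9) : monochromatic interval_coloring [set x; y; z].
  have [i /and3P[xy xz yz]] := interval_coloring_triple x y z.
  exists i; apply: cliqueP => u v; rewrite !inE -!orbA.
  by do 2![case/or3P=> /eqP->]; rewrite ?eqxx // => nuv;
    rewrite /= /interval_adj nuv //= /overlap andbC.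
split=> [x y nxy|S S3|//].
  (* An edge is a degenerate triple. *)
  have [i ci] := cl x y x; exists i.
  by apply: (clique_edge ci); rewrite ?inE ?eqxx ?orbT.
have /card_gt0P[x xS] : 0 < #|S| by rewrite S3.
have /card_gt0P[y] : 0 < #|S :\ x|.
  by move: S3; rewrite (cardsD1 x) xS add1n => -[->].
rewrite !inE => /andP[yx yS].
have yS' : y \in S :\ x by rewrite !inE yx.
have /cards1P[z Sz] : #|(S :\ x) :\ y| == 1.
  by move: S3; rewrite (cardsD1 x) xS (cardsD1 y) yS' !add1n => -[->].
by rewrite -(setD1K xS) -(setD1K yS') Sz setUA.
Qed.

Lemma interval_coloring_interval (R : realType) (i : 'I_3) :
  interval_graph R (interval_coloring i).
Proof.
exists (fun v : 'I_9 => (left_end (shift i v))%:R)%R.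
exists (fun v : 'I_9 => (right_end (shift i v))%:R)%R.
split=> [v|u v nuv].
  by rewrite Num.Theory.ler_nat left_le_right.
rewrite /= /interval_adj nuv /= /overlap; split=> [/andP[uv vu]|[x []]].
  (* The larger left end is a common point of two overlapping intervals. *)
  exists (maxn (left_end (shift i u)) (left_end (shift i v)))%:R%R.
  rewrite !in_itv /= !Num.Theory.ler_nat !geq_max !leq_max !leqnn !orbT.
  by rewrite !left_le_right uv vu.
rewrite !in_itv /= => /andP[ux xu] /andP[vx xv].
by rewrite -!(Num.Theory.ler_nat R) (Order.POrderTheory.le_trans ux xv)
  (Order.POrderTheory.le_trans vx xu).
Qed.

(** * Exclusion of covers by two cliques *)

Fixpoint bitseqs (n : nat) : seq bitseq :=
  if n is n'.+1 then
    map (cons true) (bitseqs n') ++ map (cons false) (bitseqs n')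
  else [:: [::]].

Lemma mem_bitseqs (s : bitseq) : s \in bitseqs (size s).
Proof. by elim: s => //= -[] s IH; rewrite mem_cat map_f ?orbT. Qed.

(* [s] assigns each vertex to a clique of color [j] (true) or [k] (false). *)
Definition split_ok (j k : nat) (s : bitseq) :=
  all (fun x => all (fun y => (nth false s x == nth false s y) ==>
    (if nth false s x then overlap j x y else overlap k x y))
  (iota 0 9)) (iota 0 9).

(** Such a cover would split the nine vertices into [S] and a part of [T]; all 2^9 splits are
    refuted by computation for each pair of different colors. *)
Lemma interval_coloring_no_2_cover (j k : 'I_3) (S T : {set 'I_9}) :
  j != k -> clique (interval_coloring j) S -> clique (interval_coloring k) T ->
  S :|: T != setT.
Proof.
move=> jk cS cT; apply/eqP => ST.
have : all (fun j => all (fun k =>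
    (j == k) || ~~ has (split_ok j k) (bitseqs 9))
  (iota 0 3)) (iota 0 3) by vm_compute.
move/allP/(_ j); rewrite mem_iota => /(_ (ltn_ord j)).
move/allP/(_ k); rewrite mem_iota => /(_ (ltn_ord k)).
rewrite [_ == _](negPf jk) orFb => /hasPn none.
(* A vertex in both cliques is counted in [S]; the bit false means membership in [T], since the two
   sets cover everything. *)
pose s := [seq inord x \in S | x <- iota 0 9].
move/negP: (none s (mem_bitseqs s)); apply.
have sE (x : 'I_9) : nth false s x = (x \in S).
  by rewrite (nth_map 0) ?size_iota // nth_iota // inord_val.
have edge (i : 'I_3) (U : {set 'I_9}) (x y : 'I_9) :
    clique (interval_coloring i) U -> x \in U -> y \in U -> overlap i x y.
  move=> cU xU yU; case: (eqVneq x y) => [->|nxy].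
    by rewrite /overlap left_le_right.
  by have /andP[] := clique_edge cU xU yU nxy.
apply/allP=> x; rewrite mem_iota => x9; apply/allP=> y; rewrite mem_iota => y9.
have := (sE (Ordinal x9), sE (Ordinal y9)); rewrite /= => -[-> ->].
apply/implyP=> /eqP eS; case: ifPn => xS.
  by apply: (edge j S (Ordinal x9) (Ordinal y9)); rewrite -?eS.
have inT (v : 'I_9) : v \notin S -> v \in T.
  move=> vS; have: v \in S :|: T by rewrite ST inE.
  by rewrite inE (negPf vS).
by apply: (edge k T (Ordinal x9) (Ordinal y9)); rewrite ?inT // -eS.
Qed.

(** In each color the intervals starting at 0 share the point 0. In color 0 they belong to 0, 2, 4,
    5, 8, which meet every residue class modulo 3, so the translates cover Z/9. This ensures that
    [theta] is attained by a genuine cover. *)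
Lemma interval_coloring_cover : exists C, strong_cover interval_coloring C.
Proof.
apply: (@strong_cover_of_cliques _ _ _
  (fun i : 'I_3 => [set v : 'I_9 | left_end (shift i v) == 0])) => [i|v].
  apply: cliqueP => x y; rewrite !inE => /eqP x0 /eqP y0 nxy.
  by rewrite /= /interval_adj nxy /overlap x0 y0.
have /allP/(_ v) : all (fun v => has (fun i => left_end (shift i v) == 0)
  (iota 0 3)) (iota 0 9) by [].
rewrite mem_iota => /(_ (ltn_ord v))/hasP[i].
by rewrite mem_iota => i3 h; exists (Ordinal i3); rewrite inE.
Qed.

(** A cover with fewer than three cliques misses a color [i], so the cliques of the two other colors
    [j] and [k] would already cover all vertices. *)
Lemma theta_interval_coloring : theta interval_coloring = 3.
Proof.
have [C sC ->] := theta_strong_cover interval_coloring_cover.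
apply/eqP; rewrite eqn_leq (strong_cover_card sC) leqNgt; apply/negP => C3.
have [S [cS cov S0]] := cliques_of_strong_cover sC.
have /subsetPn[i _ /S0 iS] : ~~ ([set: 'I_3] \subset fst @: C).
  apply/negP=> /subset_leq_card; rewrite cardsT card_ord leqNgt.
  by rewrite (leq_ltn_trans (leq_imset_card _ _)).
have [j [k [jk ijk]]] : exists j k : 'I_3, j != k /\
    forall l, [\/ l = i, l = j | l = k].
  case: (ord3P i) => ->.
  - exists (inord 1), (inord 2); split; last exact: ord3P.
    by rewrite -val_eqE /= !inordK.
  - exists ord0, (inord 2); split; first by rewrite -val_eqE /= !inordK.
    by move=> l; case: (ord3P l); [apply: Or32|apply: Or31|apply: Or33].
  - exists ord0, (inord 1); split; first by rewrite -val_eqE /= !inordK.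
    by move=> l; case: (ord3P l); [apply: Or32|apply: Or33|apply: Or31].
have /eqP[] := interval_coloring_no_2_cover jk (cS j) (cS k).
apply/setP=> v; rewrite !inE; have [l] := cov v.
by case: (ijk l) => ->; rewrite ?iS ?inE // => ->; rewrite ?orbT.
Qed.

Theorem theorem1p6 (R : realType) :
  (forall (n : nat) (G : 'I_3 -> sgraph 'I_n),
     tk_coloring 3 G -> (forall i, chordal (G i)) ->
     (exists C, strong_cover G C) /\ theta G <= 3)
  /\
  (exists G : 'I_3 -> sgraph 'I_9,
     [/\ tk_coloring 3 G,
         forall i, interval_graph R (G i)
       & theta G = 3]).
Proof.
have cover3 n (G : 'I_3 -> sgraph 'I_n) :
    (exists C, strong_cover G C) -> theta G <= 3.
  by case/theta_strong_cover=> C sC ->; apply: strong_cover_card sC.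
split=> [n G G33 chG|].
  by have ex := chordal_33_strong_cover G33 chG; split; last exact: cover3.
exists interval_coloring; split; first exact: interval_coloring_33.
  by move=> i; apply: interval_coloring_interval.
exact: theta_interval_coloring.
Qed.
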